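(* Let $n\ge 2$, $A\in\mathbb R^{n\times n}$ and $B\in\mathbb R^{n\times 1}$, and suppose $(A,B)$ is a controllable pair, i.e. $\mathrm{rank}\,[B\ \ AB\ \ \ldots\ \ A^{n-1}B]=n$. Define matrices $Y_0:=\mathrm{null}(B^{T})$ and $$Y_{i}:=\mathrm{null}\big(\big[\mathrm{null}((A^{T}Y_{i-1})^{T})\ \ B\big]^{T}\big),\qquad i=1,\ldots,n-2,$$ and put $Y:=Y_{n-2}$. Let $$K_2:=\frac{(A^{T}Y)^{T}}{(A^{T}Y)^{T}B},\qquad K:=K_2A .$$ Then $K\in\mathbb R^{1\times n}$ is well defined and is a deadbeat gain for the system $\hat x^{+}=A\hat x+Bu$, that is, the matrix $A-BK$ is nilpotent.
   Context: For a matrix $M\in\mathbb R^{r\times n}$ whose null space has dimension $k$, $\mathrm{null}(M)$ denotes some (arbitrarily chosen) $n\times k$ matrix whose columns span the null space of $M$. $[P\ \ Q]$ denotes horizontal concatenation of matrices. The matrix $A$ is not assumed invertible. ''Well defined'' means that $(A^TY)^TB$ is a nonzero scalar. *)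

(* Defs.v *)
From mathcomp Require Import all_boot all_order all_algebra reals.

Set Implicit Arguments.
Unset Strict Implicit.
Unset Printing Implicit Defensive.

Import Order.TTheory GRing.Theory Num.Theory.
Local Open Scope ring_scope.

(* [is_null M N]: N is an admissible choice of null(M). MathComp's [kermx] is
   the left kernel and its subspaces are row spaces, whence the transposes: the
   row space of [kermx M^T] is {x^T | M x = 0}, and that of [N^T] is the span of
   the columns of N. Each null(M) is thus a relation rather than a function, so
   that all choices are covered, independently of one another. *)
Definition is_null (R : realType) (r n k : nat)
    (M : 'M[R]_(r, n)) (N : 'M[R]_(n, k)) : Prop :=
  k = \rank (kermx M^T) /\ (N^T == kermx M^T)%MS.

Lemma is_null_exists (R : realType) (r n : nat) (M : 'M[R]_(r, n)) :
  exists N : 'M[R]_(n, \rank (kermx M^T)), is_null M N.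
Proof.
exists (row_base (kermx M^T))^T; split=> //.
by rewrite trmxK !eq_row_base !submx_refl.
Qed.

Definition controllable (R : realType) (n : nat)
    (A : 'M[R]_n) (B : 'cV[R]_n) : Prop :=
  \rank (\mxrow_(j < n) (A ^+ j *m B)) = n.

(* The denominator of K_2, as a scalar; it requires Y to have one column. *)
Definition gain_denom (R : realType) (n : nat)
    (A : 'M[R]_n) (B Y : 'cV[R]_n) : R :=
  ((A^T *m Y)^T *m B) 0 0.

Definition gain2 (R : realType) (n : nat)
    (A : 'M[R]_n) (B Y : 'cV[R]_n) : 'rV[R]_n :=
  (gain_denom A B Y)^-1 *: (A^T *m Y)^T.

Definition gain (R : realType) (n : nat)
    (A : 'M[R]_n) (B Y : 'cV[R]_n) : 'rV[R]_n :=
  gain2 A B Y *m A.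

Definition nilpotent_mx (R : realType) (n : nat) (M : 'M[R]_n) : Prop :=
  exists m : nat, M ^+ m = 0.

Definition deadbeat_gain (R : realType) (n : nat)
    (A : 'M[R]_n) (B : 'cV[R]_n) (K : 'rV[R]_n) : Prop :=
  nilpotent_mx (A - B *m K).

(* Main.v *)
(** Transposing, let [W_i] be the row space of [(Y i)^T].  Since taking null
    spaces twice is the identity on subspaces, [W_(i+1)] is the intersection of
    [W_i A] with the annihilator of [B], so that [W_i] consists of the rows
    [u A^i] with [u A^j B = 0] for all [j <= i].  Controllability says that a row
    killing every [A^j B], [j < n], is zero; hence the rows killing
    [B, ..., A^(n-2) B] form a line spanned by some [v] with [v A^(n-1) B <> 0].
    So [W_(n-2)] is the line through [v A^(n-2)], and [K] is Ackermann's gain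
    [v A^n / (v A^(n-1) B)].  With [M = A - B K] one gets [v M^j = v A^j] for
    [j < n] and [v M^n = 0]; as the [v A^j], [j < n], form a basis, [M^n = 0]. *)
Require Import Defs.
From mathcomp Require Import all_boot all_order all_algebra reals.
From mathcomp Require Import zify.

Set Implicit Arguments.
Unset Strict Implicit.
Unset Printing Implicit Defensive.

Import Order.TTheory GRing.Theory Num.Theory.
Local Open Scope ring_scope.

(** Double annihilator: one inclusion is immediate, and both ranks equal [m - (m - \rank W)]. *)
Lemma kermx_tr_kermx (F : fieldType) (m n : nat) (W : 'M[F]_(m, n)) :
  (kermx (kermx W)^T :=: W^T)%MS.
Proof.
apply/eqmxP.
have sW : (W^T <= kermx (kermx W)^T)%MS.
  by apply/sub_kermxP; rewrite -trmx_mul mulmx_ker trmx0.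
rewrite sW andbT -(mxrank_leqif_sup sW).2 mxrank_ker !mxrank_tr mxrank_ker.
by rewrite subKn ?rank_leq_row.
Qed.

Section Null.

Variables (R : realType) (r n k : nat) (M : 'M[R]_(r, n)) (N : 'M[R]_(n, k)).
Hypothesis nullN : is_null M N.

Lemma is_null_rank : k = \rank N^T.
Proof. by case: nullN => kE /eqmxP eqNK; rewrite eqNK. Qed.

Lemma sub_is_null (x : 'rV_n) : (x <= N^T)%MS = (x *m M^T == 0).
Proof. by case: nullN => _ /eqmxP->; apply/sub_kermxP/eqP. Qed.

Lemma mul_is_null_eq0 (x : 'rV_n) : (x *m N == 0) = (x <= M)%MS.
Proof.
case: nullN => _ /andP[sNK sKN].
rewrite -[M in RHS]trmxK -kermx_tr_kermx; apply/eqP/sub_kermxP => x0.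
  have /submxP[D ->] := sKN.
  by rewrite trmx_mul trmxK mulmxA x0 mul0mx.
have /submxP[D NE] := sNK.
by rewrite -[N]trmxK NE trmx_mul mulmxA x0 mul0mx.
Qed.

End Null.

Section Krylov.

Variables (F : fieldType) (n : nat) (A : 'M[F]_n) (B : 'cV[F]_n).

Lemma ackermann_nilpotent (u : 'rV[F]_n) : (0 < n)%N ->
    (forall j, (j < n.-1)%N -> u *m A ^+ j *m B = 0) ->
    (u *m A ^+ n.-1 *m B) 0 0 != 0 ->
  (A - B *m (((u *m A ^+ n.-1 *m B) 0 0)^-1 *: (u *m A ^+ n))) ^+ n = 0.
Proof.
move=> n_gt0 u0; set c := (_ *m _) 0 0 => c0; set M := A - _.
have powE (X : 'M[F]_n) : X ^+ n = X ^+ n.-1 *m X.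
  by rewrite mulmxE -exprSr prednK.
have uM j : (j < n)%N -> u *m M ^+ j = u *m A ^+ j.
  elim: j => [//|j IH] ltjn.
  rewrite exprSr -mulmxE mulmxA IH; last exact: ltnW.
  rewrite /M mulmxBr [u *m _ *m (B *m _)]mulmxA u0; last by rewrite ltn_predRL.
  by rewrite mul0mx subr0 exprSr -mulmxE mulmxA.
have uMn : u *m M ^+ n = 0.
  rewrite powE mulmxA uM ?prednK //.
  rewrite /M mulmxBr [u *m _ *m (B *m _)]mulmxA [u *m _ *m B]mx11_scalar -/c.
  rewrite mul_scalar_mx scalerA divff // scale1r powE mulmxA.
  by rewrite subrr.
(* The product of [O] with the columns [A^(n-1-j) B] is lower triangular with
   constant diagonal [c]. *)
pose O := \matrix_(i < n) (u *m A ^+ i).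
pose H := \matrix_(i < n, j < n) (A ^+ (n.-1 - j) *m B) i 0.
have OH i j : (O *m H) i j = (u *m A ^+ (i + (n.-1 - j)) *m B) 0 0.
  rewrite exprD -mulmxE mulmxA -[_ *m _ *m B]mulmxA !mxE.
  by apply: eq_bigr => l _; rewrite !mxE.
have unitO : O \in unitmx.
  suff: O *m H \in unitmx by rewrite unitmx_mul => /andP[].
  have trigOH : is_trig_mx (O *m H).
    apply/is_trig_mxP => i j ltij; rewrite OH u0 ?mxE //.
    by have := ltn_ord j; lia.
  rewrite unitmxE det_trig // unitfE prodf_seq_neq0; apply/allP => i _ /=.
  by rewrite OH subnKC // -ltnS prednK.
(* Powers of [M] commute, so row [i] is [u *m M ^+ n *m M ^+ i], which vanishes. *)
have OM : O *m M ^+ n = 0.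
  apply/row_matrixP => i; rewrite row_mul rowK row0 -uM // -mulmxA mulmxE.
  by rewrite -exprD addnC exprD -mulmxE mulmxA uMn mul0mx.
by rewrite -[M ^+ n]mul1mx -(mulVmx unitO) -mulmxA OM mulmx0.
Qed.

Hypothesis ctrlAB :
  forall u : 'rV[F]_n, (forall j, (j < n)%N -> u *m A ^+ j *m B = 0) -> u = 0.

(** The columns of [C] are the [A ^+ j *m B]; controllability makes [C] invertible, and [v] is the
    last row of its inverse. *)
Lemma dual_krylov_row : (0 < n)%N ->
  exists v : 'rV[F]_n, (forall j, (j < n.-1)%N -> v *m A ^+ j *m B = 0) /\
    v *m A ^+ n.-1 *m B = 1%:M.
Proof.
move=> n_gt0; pose C := \matrix_(i < n, j < n) (A ^+ j *m B) i 0.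
have mulC (u : 'rV_n) (j : 'I_n) : (u *m C) 0 j = (u *m A ^+ j *m B) 0 0.
  by rewrite -mulmxA !mxE; apply: eq_bigr => l _; rewrite !mxE.
have unitC : C \in unitmx.
  rewrite -row_free_unit -kermx_eq0; apply/eqP/row_matrixP => i; rewrite row0.
  apply: ctrlAB => j ltjn; rewrite [LHS]mx11_scalar.
  rewrite -(mulC _ (Ordinal ltjn)) -row_mul mulmx_ker row0 mxE.
  by rewrite -scalemx1 scale0r.
have ltn1 : (n.-1 < n)%N by rewrite prednK.
exists (row (Ordinal ltn1) (invmx C)); split=> [j ltj|].
  have ltjn : (j < n)%N by apply: leq_trans ltn1; apply: ltnW.
  rewrite [LHS]mx11_scalar -(mulC _ (Ordinal ltjn)) -row_mul mulVmx //.
  by rewrite !mxE -val_eqE /= gtn_eqF // -scalemx1 scale0r.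
rewrite [LHS]mx11_scalar -(mulC _ (Ordinal ltn1)) -row_mul mulVmx //.
by rewrite !mxE eqxx.
Qed.

End Krylov.

Lemma controllable_eq0 (R : realType) (n : nat) (A : 'M[R]_n) (B : 'cV[R]_n)
    (u : 'rV[R]_n) : controllable A B ->
  (forall j, (j < n)%N -> u *m A ^+ j *m B = 0) -> u = 0.
Proof.
move=> rkC u0; have freeC : row_free (\mxrow_(j < n) (A ^+ j *m B)).
  exact/eqP.
apply: (row_free_inj freeC); rewrite mul0mx mul_mxrow.
by apply/matrixP => i j; rewrite mxE mulmxA u0 // !mxE.
Qed.

Lemma sub_null_iter (R : realType) (n N : nat) (A : 'M[R]_n) (B : 'cV[R]_n)
    (k l : nat -> nat)
    (Y : forall i : nat, 'M[R]_(n, k i)) (Z : forall i : nat, 'M[R]_(n, l i))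
    (hY0 : is_null B^T (Y 0%N))
    (hZ : forall i : nat, (i < N)%N -> is_null (A^T *m Y i)^T (Z i))
    (hY : forall i : nat, (i < N)%N -> is_null (row_mx (Z i) B)^T (Y i.+1))
    (i : nat) (x : 'rV[R]_n) : (i <= N)%N ->
  (x <= (Y i)^T)%MS <->
  exists2 u : 'rV[R]_n, x = u *m A ^+ i &
    forall j, (j <= i)%N -> u *m A ^+ j *m B = 0.
Proof.
elim: i x => [|i IH] x leiN.
  rewrite (sub_is_null hY0) trmxK; split=> [/eqP x0|[u -> u0]].
    by exists x => [|[|//] _]; rewrite expr0 mulmx1.
  by rewrite u0.
(* The inner null space is undone by the double annihilator, leaving the rows of [(Y i)^T *m A] that
   kill [B]. *)
have -> : (x <= (Y i.+1)^T)%MS = (x <= (Y i)^T *m A)%MS && (x *m B == 0).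
  rewrite (sub_is_null (hY i leiN)) trmxK mul_mx_row row_mx_eq0.
  by rewrite (mul_is_null_eq0 (hZ i leiN)) trmx_mul trmxK.
split=> [/andP[/submxP[D xE] /eqP xB]|[u xE u0]].
  have /(IH _ (ltnW leiN))[u DE u0] : (D *m (Y i)^T <= (Y i)^T)%MS.
    exact: submxMl.
  have xu : x = u *m A ^+ i.+1 by rewrite xE mulmxA DE exprSr -mulmxE mulmxA.
  exists u => // j; rewrite leq_eqVlt => /orP[/eqP->|]; last exact: u0.
  by rewrite -xu.
rewrite xE u0 // eqxx andbT exprSr -mulmxE mulmxA submxMr //.
apply/(IH _ (ltnW leiN)); exists u => // j leji; apply: u0; exact: leqW.
Qed.

(* Z i is the inner matrix null((A^T Y_i)^T) occurring in the definition of
   Y_{i+1}; k i and l i are the numbers of columns of Y i and Z i. The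
   conclusion first asserts that Y_{n-2} has a single column, which is what
   makes (A^T Y)^T B a scalar. *)
Theorem mainTheorem6 (R : realType) (n : nat) (hn : (2 <= n)%N)
    (A : 'M[R]_n) (B : 'cV[R]_n) (hAB : controllable A B)
    (k l : nat -> nat)
    (Y : forall i : nat, 'M[R]_(n, k i)) (Z : forall i : nat, 'M[R]_(n, l i))
    (hY0 : is_null B^T (Y 0%N))
    (hZ : forall i : nat, (i < n - 2)%N -> is_null (A^T *m Y i)^T (Z i))
    (hY : forall i : nat, (i < n - 2)%N ->
            is_null (row_mx (Z i) B)^T (Y i.+1)) :
  exists e : k (n - 2)%N = 1%N,
    let Yend : 'cV[R]_n := castmx (erefl n, e) (Y (n - 2)%N) in
    gain_denom A B Yend != 0 /\ deadbeat_gain A B (gain A B Yend).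
Proof.
have n_gt0 : (0 < n)%N by apply: ltnW.
have n1E : n.-1 = (n - 2).+1 by rewrite -subn1 -subSn.
have ctrl u := @controllable_eq0 _ _ _ _ u hAB.
have [v [v0 v1]] := dual_krylov_row ctrl n_gt0.
have subY x := sub_null_iter hY0 hZ hY x (leqnn (n - 2)).
pose w := v *m A ^+ (n - 2).
have kE : k (n - 2)%N = \rank (Y (n - 2)%N)^T.
  case: (n - 2)%N hY => [_|m hY']; first exact: is_null_rank hY0.
  exact: is_null_rank (hY' m (ltnSn m)).
have Yw : ((Y (n - 2)%N)^T :=: w)%MS.
  apply/eqmxP/andP; split; last first.
    by apply/subY; exists v => // j lej; apply: v0; rewrite n1E.
  apply/row_subP => i.
  have /subY[u -> u0] := row_sub i (Y (n - 2)%N)^T.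
  (* The difference of the two sides kills every [A ^+ j *m B] with [j < n]: for [j < n.-1] both
     terms do, and the coefficient is chosen for [j = n.-1]. *)
  suff -> : u = (u *m A ^+ n.-1 *m B) 0 0 *: v.
    by rewrite -scalemxAl scalemx_sub.
  apply/subr0_eq/ctrl => j ltjn; rewrite 2!mulmxBl -!scalemxAl.
  have [ltj|gej] := ltnP j n.-1.
    have lej : (j <= n - 2)%N by lia.
    by rewrite (v0 _ ltj) (u0 _ lej) scaler0 subr0.
  have -> : j = n.-1 by lia.
  by rewrite v1 scalemx1 -mx11_scalar subrr.
have w0 : w != 0.
  apply/eqP => w0; have := v1; rewrite n1E exprSr -mulmxE mulmxA -/w w0 !mul0mx.
  by move/matrixP/(_ 0 0)/eqP; rewrite !mxE eq_sym oner_eq0.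
have e : k (n - 2)%N = 1%N by rewrite kE Yw rank_rV w0.
exists e; set y : 'cV_n := castmx _ _; cbv zeta.
have yw : (y^T :=: w)%MS.
  by rewrite /y trmx_cast /=; apply: eqmx_trans Yw; apply: eqmx_cast.
have /sub_rVP[a yE] : (y^T <= w)%MS by rewrite yw.
have a0 : a != 0.
  apply: contraNneq w0 => a0; rewrite -mxrank_eq0 -yw yE a0.
  by rewrite scale0r mxrank0.
(* The choice of basis only replaces [v] by [a *: v] with [a] nonzero, so Ackermann's formula
   applies with [u := a *: v]. *)
have yA : (A^T *m y)^T = a *: v *m A ^+ n.-1.
  by rewrite trmx_mul trmxK yE n1E exprSr -mulmxE /w mulmxA -!scalemxAl.
have dE : gain_denom A B y = ((a *: v) *m A ^+ n.-1 *m B) 0 0.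
  by rewrite /gain_denom yA.
have d0 : ((a *: v) *m A ^+ n.-1 *m B) 0 0 != 0.
  by rewrite -!scalemxAl v1 !mxE mulr1.
split; first by rewrite dE.
exists n; rewrite /gain /gain2 dE yA -[X in B *m X]scalemxAl.
rewrite -[(a *: v) *m _ *m A]mulmxA.
have <- : A ^+ n = A ^+ n.-1 *m A by rewrite mulmxE -exprSr prednK.
apply: ackermann_nilpotent => // j ltj.
by rewrite -!scalemxAl v0 // scaler0.
Qed.
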